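(* Let $(A,A_{\operatorname{tr}},\mathbb K_I,\operatorname{tr}_A)$ and $(B,B_{\operatorname{tr}},\mathbb K_c,\operatorname{tr}_B)$ be filtered differential graded algebras with trace, and let $\phi\colon A\to B$ be a morphism of algebras with trace between them whose map on trace targets is the canonical map $\mathbb K_I\to\mathbb K_c$ (the identity of $\mathbb K$). Let $H\in C^\omega_{\mathcal R}(A_{\operatorname{tr}})$, with expansion $H(t)=\sum_{n\ge N}H_nt^n$ near $t=0$, let $h=[H_0]\in\operatorname{gr}^0A$, and assume that $\phi(H)$ has constant trace. Then $$\operatorname{tr}_B\left(\phi(H)|_1\right)=\operatorname{tr}_{\operatorname{gr}^0A}(h).$$
   Context: $\mathbb K$ is a commutative $\mathbb R$-algebra (ground ring). Complexes are cochain complexes of $\mathbb K$-modules. A filtered complex $(C,F)$ is a complex with an increasing $\mathbb Z$-indexed filtration by subcomplexes $F^aC$; morphisms are filtration-preserving cochain maps. $\mathbb K_I$ is $\mathbb K$ in degree $0$ with $I^a\mathbb K=0$ for $a<0$, $I^a\mathbb K=\mathbb K$ for $a\ge0$; $\mathbb K_c$ is $\mathbb K$ with the constant filtration ($F^a=\mathbb K$ for all $a$). A filtered differential graded algebra (FDGA) is a (not necessarily unital) filtered complex $A$ with an associative product given by a morphism of filtered complexes $A\otimes A\to A$. An FDGA with trace $(A,A_{\operatorname{tr}},P,\operatorname{tr}_A)$ consists of an FDGA $A$, a two-sided differential ideal $A_{\operatorname{tr}}\subseteq A$ (filtered by $F^nA_{\operatorname{tr}}=A_{\operatorname{tr}}\cap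 F^nA$), a filtered complex $P$, and a continuous filtered cochain map $\operatorname{tr}_A\colon A_{\operatorname{tr}}\to P$ vanishing on graded commutators $\{x,a\}=xa-(-1)^{|x||a|}ax$, $x\in A$, $a\in A_{\operatorname{tr}}$. A morphism $(A,A_{\operatorname{tr}},P,\operatorname{tr}_A)\to(B,B_{\operatorname{tr}},Q,\operatorname{tr}_B)$ is an FDGA morphism $\phi\colon A\to B$ with $\phi(A_{\operatorname{tr}})\subseteq B_{\operatorname{tr}}$ together with a filtered cochain map $\bar\phi\colon P\to Q$ with $\bar\phi\circ\operatorname{tr}_A=\operatorname{tr}_B\circ\phi$ on $A_{\operatorname{tr}}$. The underlying real vector spaces are assumed to be separated locally convex spaces. For a filtered complex $C$, $C^\omega_{\mathcal R}(C)$ is the set of smooth maps $a\colon\mathbb R_{>0}\to C$ for which there are $\varepsilon>0$, $N\in\mathbb Z$ and $a_n\in F^nC$ with $a(t)=\sum_{n\ge N}a_nt^n$ for $0<t<\varepsilon$. Morphisms act pointwise: $\phi(H)(t)=\phi(H(t))$; $a|_1=a(1)$. An element $b\in C^\omega_{\mathcal R}(B)$ with $b(t)\in B_{\operatorname{tr}}$ for all $t>0$ has constant trace if $\operatorname{tr}_B(b(t))$ is independent of $t>0$. $\operatorname{gr}^0A=F^0A/F^{-1}A$, and $\operatorname{tr}_{\operatorname{gr}^0A}([a])=\operatorname{tr}_A(a)\in\mathbb K$ for $a\in F^0A_{\operatorname{tr}}$ is the induced trace. *)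

(* Defs.v *)
From HB Require Import structures.
From mathcomp Require Import all_boot all_order all_algebra.
From mathcomp Require Import all_classical all_reals all_analysis.

Set Implicit Arguments.
Unset Strict Implicit.
Unset Printing Implicit Defensive.

Import Order.TTheory GRing.Theory Num.Theory.
Import numFieldNormedType.Exports.

Local Open Scope classical_set_scope.
Local Open Scope ring_scope.
Local Open Scope quotient_scope.

HB.mixin Record Topological_isHausdorff T & Topological T := {
  hausdorff_subproof : hausdorff_space T
}.

(* The ground ring: a commutative R-algebra which is also a separated locally
   convex space over R.  No joint continuity of the product is required. *)
#[short(type="lcAlgType")]
HB.structure Definition LcAlgebra (R : realType) :=
  {K of GRing.ComAlgebra R K & Tvs R K & Topological_isHausdorff K}.

(* K-modules with a separated locally convex topology on the underlying real
   vector space.  The R-action comes from tvsType; since a type carries a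
   single canonical scaling, the K-action is an explicit operation, which
   extends the R-action along r |-> r%:A. *)
Record kModule (R : realType) (K : lcAlgType R) := KModule {
  km_sort :> tvsType R;
  km_hausdorff : hausdorff_space km_sort;
  kscale : K -> km_sort -> km_sort;
  kscaleA : forall k l x, kscale k (kscale l x) = kscale (k * l) x;
  kscaleDl : forall k l x, kscale (k + l) x = kscale k x + kscale l x;
  kscaleDr : forall k x y, kscale k (x + y) = kscale k x + kscale k y;
  kscale_alg : forall (r : R) x, kscale r%:A x = r *: x }.

Definition submodule (R : realType) (K : lcAlgType R) (C : kModule K)
    (S : set C) :=
  [/\ S 0, forall x y, S x -> S y -> S (x + y)
    & forall k x, S x -> S (kscale k x)].

Definition klinear_on (R : realType) (K : lcAlgType R) (C D : kModule K)
    (S : set C) (f : C -> D) :=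
  (forall x y, S x -> S y -> f (x + y) = f x + f y) /\
  (forall k x, S x -> f (kscale k x) = kscale k (f x)).

(* Cochain complexes are the total spaces of their internal direct sum
   decompositions: hproj i x is the component of degree i of x, almost all
   components of x vanish, and x is homogeneous of degree i iff
   hproj i x = x. *)
Record cochainComplex (R : realType) (K : lcAlgType R) := CochainComplex {
  cc_module :> kModule K;
  hproj : int -> cc_module -> cc_module;
  hproj_linear : forall i, klinear_on setT (hproj i);
  hproj_comp : forall i j x,
    hproj i (hproj j x) = if i == j then hproj j x else 0;
  hproj_sum : forall x,
    exists2 s : seq int, uniq s & x = \sum_(i <- s) hproj i x;
  cdiff : cc_module -> cc_module;
  diff_linear : klinear_on setT cdiff;
  diff_deg : forall i x, hproj (i + 1) (cdiff x) = cdiff (hproj i x);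
  diff_diff : forall x, cdiff (cdiff x) = 0 }.

Definition homogeneous (R : realType) (K : lcAlgType R)
  (C : cochainComplex K) (i : int) : set C := [set x | hproj i x = x].

Definition subcomplex (R : realType) (K : lcAlgType R)
    (C : cochainComplex K) (S : set C) :=
  [/\ submodule S, forall i x, S x -> S (hproj i x)
    & forall x, S x -> S (cdiff x)].

Record filteredComplex (R : realType) (K : lcAlgType R) := FilteredComplex {
  fc_complex :> cochainComplex K;
  fil : int -> set fc_complex;
  fil_subcomplex : forall a, subcomplex (fil a);
  fil_incr : forall a b, a <= b -> fil a `<=` fil b }.

Arguments fil {R K} f _ _.

(* Filtered cochain maps S -> D, where S is a subcomplex of C filtered by
   S `&` fil C n; the values of f outside S are irrelevant. *)
Record filtered_map_on (R : realType) (K : lcAlgType R)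
    (C D : filteredComplex K) (S : set C) (f : C -> D) : Prop := {
  fm_linear : klinear_on S f;
  fm_deg : forall i x, S x -> f (hproj i x) = hproj i (f x);
  fm_diff : forall x, S x -> f (cdiff x) = cdiff (f x);
  fm_fil : forall n x, S x -> fil C n x -> fil D n (f x) }.

(* The product is a morphism of filtered complexes A (x)_K A -> A, written out
   as a K-bilinear map. *)
Record fdga (R : realType) (K : lcAlgType R) := FDGA {
  fd_complex :> filteredComplex K;
  amul : fd_complex -> fd_complex -> fd_complex;
  amul_linearl : forall y, klinear_on setT (amul ^~ y);
  amul_linearr : forall x, klinear_on setT (amul x);
  amulA : associative amul;
  amul_deg : forall i j x y,
    homogeneous i x -> homogeneous j y -> homogeneous (i + j) (amul x y);
  amul_diff : forall i x y, homogeneous i x ->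
    cdiff (amul x y) = amul (cdiff x) y + ((-1 : R) ^ i) *: amul x (cdiff y);
  amul_fil : forall a b x y,
    fil _ a x -> fil _ b y -> fil _ (a + b) (amul x y) }.

(* FDGAs with trace with values in P; continuity of the trace is with respect
   to the subspace topology of the ideal. *)
Record fdgaTrace (R : realType) (K : lcAlgType R) (P : filteredComplex K) :=
  FDGATrace {
  ft_fdga :> fdga K;
  tr_ideal : set ft_fdga;
  tr_ideal_subcomplex : subcomplex tr_ideal;
  tr_ideal_mull : forall x a, tr_ideal a -> tr_ideal (amul x a);
  tr_ideal_mulr : forall a x, tr_ideal a -> tr_ideal (amul a x);
  trace : ft_fdga -> P;
  trace_filtered : filtered_map_on tr_ideal trace;
  trace_continuous : {within tr_ideal, continuous trace};
  trace_comm : forall i j x a,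
    homogeneous i x -> homogeneous j a -> tr_ideal a ->
    trace (amul x a - ((-1 : R) ^ (i * j)) *: amul a x) = 0 }.

Arguments tr_ideal {R K P} f _.
Arguments trace {R K P} f _.

Record traceMorphism (R : realType) (K : lcAlgType R)
    (P Q : filteredComplex K) (A : fdgaTrace P) (B : fdgaTrace Q) :=
  TraceMorphism {
  tm_fun :> A -> B;
  tm_filtered : filtered_map_on setT tm_fun;
  tm_mul : forall x y, tm_fun (amul x y) = amul (tm_fun x) (tm_fun y);
  tm_ideal : forall a, tr_ideal A a -> tr_ideal B (tm_fun a);
  tm_target : P -> Q;
  tm_target_filtered : filtered_map_on setT tm_target;
  tm_trace : forall a, tr_ideal A a ->
    tm_target (trace A a) = trace B (tm_fun a) }.

Section GroundComplexes.
Variables (R : realType) (K : lcAlgType R).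

Definition K_module : kModule K.
Proof.
refine (@KModule R K K (@hausdorff_subproof R K) (fun k x => k * x) _ _ _ _).
- by move=> k l x; rewrite mulrA.
- by move=> k l x; rewrite mulrDl.
- by move=> k x y; rewrite mulrDr.
- by move=> r x; rewrite mulr_algl.
Defined.

Definition K_complex : cochainComplex K.
Proof.
refine (@CochainComplex R K K_module
  (fun (i : int) (x : K) => if i == 0 then x else 0) _ _ _ (fun _ => 0) _ _ _).
- by move=> i; split=> [x y|k x] _ /=; case: (i == 0);
    rewrite /kscale /= ?addr0 ?mulr0.
- move=> i j x /=; have [<-|ij] := eqVneq i j; first by case: (i == 0).
  have [i0|//] := eqVneq i 0; have [j0|//] := eqVneq j 0.
  by rewrite i0 j0 eqxx in ij.
- by move=> x; exists [:: 0] => //; rewrite big_seq1 eqxx.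
- by split=> [x y|k x] _ /=; rewrite /kscale /= ?addr0 ?mulr0.
- by move=> i x; case: (_ == 0).
- by [].
Defined.

Definition K_I : filteredComplex K.
Proof.
refine (@FilteredComplex R K K_complex
  (fun a : int => if a < 0 then [set 0] else setT) _ _).
- move=> a; case: (a < 0); last by [].
  split=> //=; last by move=> i x ->; case: (_ == 0).
  split=> //= [x y -> ->|k x ->]; first by rewrite addr0.
  by rewrite /kscale /= mulr0.
- move=> a b ab x; have [b0|_] := ltP b 0; last by [].
  by rewrite (le_lt_trans ab b0).
Defined.

Definition K_c : filteredComplex K.
Proof. by refine (@FilteredComplex R K K_complex (fun _ : int => setT) _ _). Defined.

(* K_I and K_c have the same underlying complex. *)
Definition canonical_IC : K_I -> K_c := fun x => x.

End GroundComplexes.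

Section Graded.
Variables (R : realType) (K : lcAlgType R) (C : filteredComplex K) (n : int).

Definition fil_pred (m : int) : pred C := fun x => x \in fil C m.

Lemma submodule_zmod_closed (S : set C) :
  submodule S -> zmod_closed (fun x => x \in S).
Proof.
case=> S0 SD SZ; split=> [|x y]; first exact: mem_set.
rewrite unfold_in => /set_mem Sx; rewrite unfold_in => /set_mem Sy.
apply/mem_set/SD => //; rewrite -scaleN1r -(kscale_alg (-1)).
exact: SZ.
Qed.

Lemma fil_zmod_closed m : zmod_closed (fil_pred m).
Proof. by apply: submodule_zmod_closed; case: (@fil_subcomplex R K C m). Qed.

HB.instance Definition _ := GRing.isZmodClosed.Build C (fil_pred n)
  (fil_zmod_closed n).

Record filType := FilType { fil_val : C; fil_valP : fil_pred n fil_val }.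
HB.instance Definition _ := [isSub for fil_val].
HB.instance Definition _ := [Choice of filType by <:].
HB.instance Definition _ := [SubChoice_isSubZmodule of filType by <:].

Definition fil_lower : pred filType := fun x => fil_pred (n - 1) (val x).

Lemma fil_lower_zmod_closed : zmod_closed fil_lower.
Proof.
have [H0 HB] := fil_zmod_closed (n - 1).
split=> [|x y]; first by rewrite unfold_in /fil_lower raddf0.
by rewrite unfold_in => xl yl; rewrite unfold_in /fil_lower raddfB; exact: HB.
Qed.

HB.instance Definition _ := GRing.isZmodClosed.Build filType fil_lower
  fil_lower_zmod_closed.

Definition fil_lower_zmodClosed : zmodClosed filType :=
  GRing.ZmodClosed.clone filType fil_lower _.

(* gr^n C = F^n C / F^(n-1) C *)
Definition gr : zmodType := {ideal_quot fil_lower_zmodClosed}.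

Definition gr_class (x : C) (xF : fil C n x) : gr :=
  \pi_gr (FilType (mem_set xF)).

Lemma gr_class_eq (x y : C) (xF : fil C n x) (yF : fil C n y) :
  gr_class xF = gr_class yF <-> fil C (n - 1) (x - y).
Proof.
rewrite (rwP eqP) -(Quotient.idealrBE fil_lower_zmodClosed) /=.
rewrite -[x in fil _ _ (x - _)]/(val (FilType (mem_set xF))).
rewrite -[y in fil _ _ (_ - y)]/(val (FilType (mem_set yF))).
by rewrite -raddfB; split=> [/set_mem|/mem_set].
Qed.

End Graded.

Section GradedTrace.
Variables (R : realType) (K : lcAlgType R) (A : fdgaTrace (K_I K)).

(* The induced trace on the image of F^0 A_tr in gr^0 A; its value does not
   depend on the representative by gr0_traceE. *)
Definition gr0_trace (h : gr A 0) : K :=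
  trace A (xget 0 [set a : A | tr_ideal A a /\
                    exists aF : fil A 0 a, gr_class aF = h]).

Lemma gr0_traceE (a : A) (aF : fil A 0 a) :
  tr_ideal A a -> gr0_trace (gr_class aF) = trace A a.
Proof.
move=> aI; rewrite /gr0_trace.
case: xgetP => [b _ [bI [bF]] /gr_class_eq baF | /(_ a)]; last first.
  by case; split=> //; exists aF.
have [[_ ID IZ] _ _] := tr_ideal_subcomplex A.
have [[trD _] _ _ trF] := trace_filtered A.
have baI : tr_ideal A (b - a).
  by apply: ID => //; rewrite -scaleN1r -(kscale_alg (-1)); exact: IZ.
rewrite -[b in LHS](subrK a) trD// (_ : trace A (b - a) = 0) ?add0r//.
by have /= := trF _ _ baI baF.
Qed.

End GradedTrace.

Section Analytic.
Variables (R : realType) (K : lcAlgType R) (C : filteredComplex K).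

(* Below a subcomplex S of C stands for itself with the subspace topology, and
   a map R_{>0} -> S for a function R -> C of which only the values at t > 0
   matter and lie in S.  S = setT gives the notions for C itself. *)

Definition smooth_on_pos (S : set C) (a : R -> C) := exists D : nat -> R -> C,
  [/\ forall t, 0 < t -> D 0%N t = a t,
      forall k t, 0 < t -> S (D k t)
    & forall k t, 0 < t ->
        (fun h : R => h^-1 *: (D k (h + t) - D k t)) @ 0^' --> D k.+1 t].

(* a(t) = \sum_(n >= N) c_n t^n for small t > 0, with c_n in F^n S; the
   coefficients of index n < N are 0. *)
Record laurent_expansion (S : set C) (a : R -> C) (N : int) (c : int -> C) :
    Prop := {
  coef_in : forall n, S (c n);
  coef_fil : forall n, fil C n (c n);
  coef_lt : forall n, n < N -> c n = 0;
  coef_sum : exists2 e : R, 0 < e & forall t, 0 < t < e ->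
    series (fun k : nat => (t ^ (N + k%:Z)) *: c (N + k%:Z)) @ \oo --> a t }.

Definition Comega (S : set C) (a : R -> C) :=
  smooth_on_pos S a /\ exists N c, laurent_expansion S a N c.

End Analytic.

Definition has_constant_trace (R : realType) (K : lcAlgType R)
    (P : filteredComplex K) (B : fdgaTrace P) (b : R -> B) :=
  [/\ Comega setT b, forall t, 0 < t -> tr_ideal B (b t)
    & forall s t, 0 < s -> 0 < t -> trace B (b s) = trace B (b t)].

Arguments has_constant_trace {R K P} B b.

(* Main.v *)
Require Import Defs.
From mathcomp Require Import all_boot all_order all_algebra.
From mathcomp Require Import all_classical all_reals all_analysis.
From mathcomp Require Import ring lra zify.

(** The morphism of traces gives tr_A (H t) = tr_B (phi (H t)) for all t > 0,
    so tr_A (H t) is a constant, namely tr_B (phi (H 1)).  Near t = 0 the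
    continuous K-linear map tr_A can be applied termwise, so this constant is
    the sum of the series of the tr_A (H_n) t^n.  Since tr_A is filtered and
    its target K_I vanishes in negative filtration, tr_A (H_n) = 0 for n < 0:
    no pole is left, and the series is a power series.  A power series tends
    to its constant term as t tends to 0, so the constant is tr_A (H_0), which
    is the trace of the class of H_0 in gr^0.

    The last limit is the analytic point ([power_series_cvg0]).  The topology
    of K is only locally convex, so there is no norm to estimate the tail of
    the series with; convexity replaces it.  If the series converges at
    r > 0, its terms y_k = r^k x_k tend to 0.  With q = t / r and
    s = q / (1 - q), each partial sum at t is
    x_0 + \sum_k (1 - q) q^k (s y_(k+1)), that is, a convex combination of x_0
    and of the points x_0 + s y_(k+1).  For small t all these points lie in a
    given convex neighbourhood of x_0 ([near0_null_seq_translate]), hence so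
    do the partial sums ([convex_geometric_sum]), and the sum of the series
    lies in its closure.  Limits in K are unique because K is separated. *)

Set Implicit Arguments.
Unset Strict Implicit.
Unset Printing Implicit Defensive.

Import Order.TTheory GRing.Theory Num.Theory.
Import numFieldNormedType.Exports.

Local Open Scope classical_set_scope.
Local Open Scope ring_scope.

(** * Power series in locally convex spaces *)

Section PowerSeries.
Variables (R : realType) (E : tvsType R).

(** Used in both directions to change the index at which a Laurent series
    starts. *)
Lemma cvg_series_drop (u : nat -> E) (m : nat) (l : E) :
  (forall k, (k < m)%N -> u k = 0) ->
  series u @ \oo --> l <-> series (fun k => u (m + k)%N) @ \oo --> l.
Proof.
move=> u0; have sE n : series u (n + m)%N = series (fun k => u (m + k)%N) n.
  rewrite series_addn [series u m]big_nat big1 ?add0r => [|k /u0//].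
  rewrite -[X in \sum_(X <= _ < _) _]add0n big_addn addnK.
  by apply: eq_bigr => k _; rewrite addnC.
split=> [ul|ul].
  rewrite -(funext sE).
  exact: cvg_comp _ _ (cvg_addnr m) ul.
apply: cvg_trans (cvg_comp _ _ (cvg_subnr m) ul).
apply: near_eq_cvg; near=> n; rewrite /= -sE subnK//.
by near: n; exists m.
Unshelve. all: by end_near. Qed.

Lemma cvg_series_to0 (u : nat -> E) (l : E) :
  series u @ \oo --> l -> u @ \oo --> 0.
Proof.
move=> ul; have -> : u = fun n => series u (n + 1)%N - series u n.
  by apply/funext => n; rewrite addn1 seriesSr addrC addKr.
rewrite -(subrr l).
apply: (@cvg_comp _ _ _ (fun n => (series u (n + 1)%N, series u n))
  (fun x : E * E => x.1 - x.2) _ (nbhs (l, l))).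
  by apply: cvg_pair => //; exact: cvg_comp _ _ (cvg_addnr 1) ul.
exact: (@sub_continuous E (l, l)).
Qed.

(** The weights (1 - q) q^k with k < m add up to 1 - q^m, and a carries the
    remaining weight q^m.  The induction is Horner's scheme: the sum for d is
    the combination, with weights 1 - q and q, of a + d 0 and of the sum for
    the shifted sequence. *)
Lemma convex_geometric_sum (U : set E) (a : E) (d : nat -> E) (q : R)
    (m : nat) :
  convex_set U -> U a -> (forall k, U (a + d k)) -> 0 <= q <= 1 ->
  U (a + \sum_(k < m) ((1 - q) * q ^+ k) *: d k).
Proof.
move=> cU Ua + /andP[q0 q1]; elim: m d => [|m IH] d Ud.
  by rewrite big_ord0 addr0.
have -> : a + \sum_(k < m.+1) ((1 - q) * q ^+ k) *: d k =
    q *: (a + \sum_(k < m) ((1 - q) * q ^+ k) *: d k.+1) +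
    (1 - q) *: (a + d 0%N).
  rewrite big_ord_recl expr0 mulr1 /= !scalerDr addrACA -scalerDl.
  rewrite [q + _]addrC subrK scale1r; congr (a + _).
  rewrite [RHS]addrC; congr (_ + _); rewrite scaler_sumr.
  by apply: eq_bigr => k _; rewrite scalerA exprS mulrCA.
have Um := IH (d \o S) (fun k => Ud k.+1).
by have /set_mem := cU _ _ (Itv01 q0 q1) (mem_set Um) (mem_set (Ud 0%N)).
Qed.

(** A null sequence is bounded, so it is absorbed by every neighbourhood of 0:
    joint continuity of the scaling at (0, 0) deals with a tail of the
    sequence, and the finitely many other terms are treated one by one. *)
Lemma near0_null_seq_translate (x : nat -> E) (a : E) (W : set E) :
  x @ \oo --> 0 -> nbhs a W -> \forall s \near 0^'+, forall n, W (a + s *: x n).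
Proof.
move=> x0 Wa.
have cont (y : E) :
    (fun z : R^o * E => a + z.1 *: z.2) z @[z --> (0 : R^o, y)] --> a.
  rewrite -[X in _ --> X]addr0 -(scale0r y).
  apply: (@cvg_comp _ _ _ (fun z : R^o * E => (a, z.1 *: z.2))
    (fun w : E * E => w.1 + w.2) _ (nbhs (a, 0 *: y))).
    by apply: cvg_pair; [exact: cvg_cst|exact: (@scale_continuous _ _ (0, y))].
  exact: (@add_continuous E (a, 0 *: y)).
have [[A B] /= [A0 B0] AB] := cont 0 _ Wa.
have [n0 _ xB] := x0 _ B0.
have xW : \forall s \near (0 : R), forall i : 'I_n0, W (a + s *: x i).
  apply: (@filter_forall _ _ (fun (i : 'I_n0) s => W (a + s *: x i)) _
    (nbhs_filter (0 : R))) => i.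
  have [[A' B'] /= [A'0 B'0] AB'] := cont (x i) _ Wa.
  apply: filterS A'0 => s As; apply: (AB' (s, x i)); split => //=.
  exact: nbhs_singleton B'0.
apply: cvg_within.
near=> s => n; have [ltn|le0n] := ltnP n n0.
  by apply: ((near xW s _) (Ordinal ltn)).
by apply: (AB (s, x n)); split => /=; [near: s|exact: xB].
Unshelve. all: by end_near. Qed.

(** Abel's continuity at 0.  The sums f t are limits of partial sums, so they
    are only controlled by closed sets; regularity of the uniform space E
    provides a neighbourhood V of x 0 whose closure lies in the given one. *)
Lemma power_series_cvg0 (x : nat -> E) (f : R -> E) (e : R) :
  0 < e ->
  (forall t, 0 < t < e -> series (fun k => t ^+ k *: x k) @ \oo --> f t) ->
  f t @[t --> 0^'+] --> x 0%N.
Proof.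
move=> e0 fE W /uniform_regular[V Vx clVW].
have [B Bconvex [Bopen Bbasis]] := @locally_convex R E.
have [U [BU Ux] UV] := Bbasis _ _ Vx.
have Unb : nbhs (x 0%N) U by apply: open_nbhs_nbhs; split=> //; exact: Bopen.
pose r := e / 2.
have r0 : 0 < r by rewrite divr_gt0.
have re : r < e by rewrite ltr_pdivrMr// mulr_natr mulr2n ltrDl.
have xr0 : (fun k => r ^+ k.+1 *: x k.+1) @ \oo --> 0.
  under eq_fun do rewrite -addn1.
  apply: (cvg_comp _ _ (cvg_addnr 1) (cvg_series_to0 (fE r _))).
  by rewrite r0.
have [d /= d0 Ud] := near0_null_seq_translate xr0 Unb.
change (\forall t \near (0 : R)^'+, W (f t)); near=> t; apply: clVW.
have t0 : 0 < t by [].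
have tr : t < r by near: t; exact: nbhs_right_lt.
have te : 0 < t < e by rewrite t0 (lt_trans tr re).
suff : closure U (f t) by apply: closureS.
apply: (closed_cvg (closure U) (@closed_closure _ U) _ _ (fE t te)).
exists 1%N => // -[//|m] _; apply: subset_closure.
pose q := t / r.
have q01 : 0 <= q <= 1.
  by rewrite divr_ge0 ?(ltW t0) ?(ltW r0)// ler_pdivrMr// mul1r ltW.
have rt : r - t != 0 by rewrite subr_eq0 gt_eqF.
(* Here s = t / (r - t) is q / (1 - q), so (1 - q) q^k s r^(k+1) = t^(k+1). *)
have -> : series (fun k => t ^+ k *: x k) m.+1 =
  x 0%N + \sum_(k < m) ((1 - q) * q ^+ k) *:
    ((t / (r - t)) *: (r ^+ k.+1 *: x k.+1)).
  rewrite seriesEord/= big_ord_recl expr0 scale1r; congr (_ + _).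
  apply: eq_bigr => k _; rewrite !scalerA; congr (_ *: _).
  rewrite /q expr_div_n !exprS/=; field.
  by rewrite rt expf_neq0 gt_eqF.
apply: (@convex_geometric_sum _ _
  (fun k => (t / (r - t)) *: (r ^+ k.+1 *: x k.+1))) => //.
- by apply: Bconvex; apply/mem_set.
- have sd : t / (r - t) < d.
    rewrite ltr_pdivrMr ?subr_gt0//.
    (* For t < r / 2 the scalar t / (r - t) is less than t / (r / 2). *)
    have : t < d * (r / 2).
      by near: t; apply: nbhs_right_lt; rewrite !(mulr_gt0, divr_gt0).
    have : t < r / 2 by near: t; apply: nbhs_right_lt; rewrite divr_gt0.
    nra.
  have s0 : 0 < t / (r - t) by rewrite divr_gt0// subr_gt0.
  by move=> k; apply: Ud => //=; rewrite sub0r normrN gtr0_norm.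
Unshelve. all: by end_near. Qed.

End PowerSeries.

(** * Laurent expansions under filtered maps *)

Section Traces.
Variables (R : realType) (K : lcAlgType R).

Lemma klinear_on0 (C D : kModule K) (S : set C) (f : C -> D) :
  S 0 -> klinear_on S f -> f 0 = 0.
Proof. by move=> S0 [fD _]; apply: (addIr (f 0)); rewrite -fD// !add0r. Qed.

Lemma submodule_sum (C : kModule K) (S : set C) (I : Type) (r : seq I)
    (a : I -> R) (c : I -> C) :
  submodule S -> (forall i, S (c i)) -> S (\sum_(i <- r) a i *: c i).
Proof.
move=> [S0 SD SZ] Sc; elim/big_ind: _ => // i _.
by rewrite -kscale_alg; exact: SZ.
Qed.

Lemma klinear_on_sum (C D : kModule K) (S : set C) (f : C -> D)
    (I : Type) (r : seq I) (a : I -> R) (c : I -> C) :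
  submodule S -> klinear_on S f -> (forall i, S (c i)) ->
  f (\sum_(i <- r) a i *: c i) = \sum_(i <- r) a i *: f (c i).
Proof.
move=> Ssub flin Sc; have [S0 SD SZ] := Ssub; have [fD fZ] := flin.
elim: r => [|i r IH]; first by rewrite !big_nil (klinear_on0 S0 flin).
rewrite !big_cons fD; [|by rewrite -kscale_alg; exact: SZ|exact: submodule_sum].
by rewrite IH -!kscale_alg fZ.
Qed.

(** The partial sums and the limit all lie in the subcomplex S, so continuity
    of f for the subspace topology of S is enough to pass to the limit. *)
Lemma laurent_expansion_map (C D : filteredComplex K) (S : set C) (f : C -> D)
    (H : R -> C) (N : int) (c : int -> C) :
  subcomplex S -> filtered_map_on S f -> {within S, continuous f} ->
  (forall t, 0 < t -> S (H t)) ->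
  laurent_expansion S H N c ->
  laurent_expansion setT (f \o H) N (f \o c).
Proof.
move=> [Ssub _ _] [flin _ _ ffil] fcont SH [cS cfil clt [e e0 csum]].
have [S0 _ _] := Ssub.
split=> [//|n|n nN|]; first exact: ffil.
  by rewrite /= clt// (klinear_on0 S0 flin).
exists e => // t /andP[t0 te].
have -> : series (fun k : nat => t ^ (N + k%:Z) *: (f \o c) (N + k%:Z)) =
          f \o series (fun k : nat => t ^ (N + k%:Z) *: c (N + k%:Z)).
  apply/funext => n; apply/esym.
  exact: (klinear_on_sum _ (fun k : nat => t ^ (N + k%:Z)) Ssub flin
    (fun k => cS _)).
have Hcvg : series (fun k : nat => t ^ (N + k%:Z) *: c (N + k%:Z)) @ \oo -->
    within S (nbhs (H t)).
  move=> W HW; have := csum t; rewrite t0 te => /(_ isT _ HW) [n0 _ n0W].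
  exists n0 => // n /n0W; apply.
  exact: (submodule_sum _ (fun k : nat => t ^ (N + k%:Z)) Ssub (fun k => cS _)).
apply: cvg_comp Hcvg _.
by have /subspace_continuousP := fcont; apply; exact: SH.
Qed.

(** Vanishing coefficients in negative degrees may still be listed (N < 0), and
    the listed ones may start late (N > 0).  Both the expansion from N and the
    power series from 0 are tails of the series started at - |N|, from which
    only null terms are dropped. *)
Lemma laurent_constant_term (C : filteredComplex K) (S : set C) (f : R -> C)
    (N : int) (c : int -> C) :
  laurent_expansion S f N c -> (forall n, n < 0 -> c n = 0) ->
  f t @[t --> 0^'+] --> c 0.
Proof.
move=> [_ _ clt [e e0 csum]] cneg.
apply: (power_series_cvg0 (x := fun k : nat => c k) e0) => t te.
pose m := `|N|%N; pose j := `|(N + m%:Z)%R|%N.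
have Nj : N = - m%:Z + j%:Z by rewrite /j gez0_abs /m; lia.
pose v (k : nat) := t ^ (- m%:Z + k%:Z) *: c (- m%:Z + k%:Z).
have vj k : (k < j)%N -> v k = 0.
  by move=> kj; rewrite /v clt ?scaler0//; lia.
have vm k : (k < m)%N -> v k = 0.
  by move=> km; rewrite /v cneg ?scaler0//; lia.
have := csum t te.
have -> : (fun k : nat => t ^ (N + k%:Z) *: c (N + k%:Z)) = fun k => v (j + k)%N.
  by apply/funext => k; rewrite /v Nj PoszD addrA.
move=> /(cvg_series_drop _ vj) /(cvg_series_drop _ vm).
have -> // : (fun k => v (m + k)%N) = fun k : nat => t ^+ k *: c k.
by apply/funext => k; rewrite /v PoszD addKr.
Qed.

End Traces.

(** * The trace at t = 1 *)

Theorem lemma3p4 (R : realType) (K : lcAlgType R)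
    (A : fdgaTrace (K_I K)) (B : fdgaTrace (K_c K))
    (phi : traceMorphism A B)
    (hphi : tm_target phi = @canonical_IC R K)
    (H : R -> A) (hH : Comega (tr_ideal A) H)
    (N : int) (Hn : int -> A)
    (hexp : laurent_expansion (tr_ideal A) H N Hn)
    (h : gr A 0) (hE : h = gr_class (coef_fil hexp 0))
    (hconst : has_constant_trace B (phi \o H)) :
  trace B (phi (H 1)) = gr0_trace h.
Proof.
have HS t : 0 < t -> tr_ideal A (H t).
  by case: hH => -[D [D0 DS _] _] t0; rewrite -D0//; exact: DS.
have trphi a : tr_ideal A a -> trace A a = trace B (phi a).
  by move=> /(tm_trace phi); rewrite hphi.
have trH t : 0 < t -> trace A (H t) = trace B (phi (H 1)).
  move=> t0; rewrite (trphi _ (HS _ t0)).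
  by have [_ _ cst] := hconst; exact: cst ltr01.
rewrite hE gr0_traceE; last exact: coef_in hexp 0.
have trexp := laurent_expansion_map (tr_ideal_subcomplex A) (trace_filtered A)
  (@trace_continuous _ _ _ A) HS hexp.
have trneg n : n < 0 -> (trace A \o Hn) n = 0.
  (* fil (K_I K) n is [set 0] for n < 0. *)
  by move=> n0; have := coef_fil trexp n; rewrite /= n0.
apply: (@cvg_unique (K_I K) (@km_hausdorff R K (K_I K)) _ _ _ _ _
  (laurent_constant_term trexp trneg)).
apply: cvg_near_cst; near=> t; apply: trH.
near: t; exact: nbhs_right_gt.
Unshelve. all: by end_near. Qed.
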